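(* Let $\beta_4,\dots,\beta_n,\gamma\in\mathbb{C}$, and let $L=F_2(\beta_4,\beta_5,\dots,\beta_n,\gamma)$ be the $n$-dimensional algebra of the second family, with basis $e_1,\dots,e_n$. The pre-derivations $P$ of $L$ have the following form, with complex numbers $a_1,\dots,a_n,b_2,b_{n-1},b_n,c_2,\dots,c_n$: $$P(e_1)=\sum_{t=1}^{n}a_te_t,\qquad P(e_2)=b_2e_2+b_{n-1}e_{n-1}+b_ne_n,\qquad P(e_3)=\sum_{t=2}^{n}c_te_t,$$ $$P(e_{2i})=(2i-1)a_1e_{2i}+\sum_{t=2i+1}^{n}\big(a_{t-2i+2}+(2i-2)a_2\beta_{t-2i+3}\big)e_t,\qquad 2\le i\le\lfloor n/2\rfloor,$$ $$P(e_{2i+1})=((2i-2)a_1+c_3)e_{2i+1}+\sum_{t=2i+2}^{n}\big(c_{t-2i+2}+(2i-2)a_2\beta_{t-2i+2}\big)e_t,\qquad 2\le i\le\lfloor (n-1)/2\rfloor,$$ where the following restrictions hold: (1) $(c_3-2a_1)\beta_4=0$, $(b_2-2a_1)\beta_4=0$, and $c_2\beta_t=0$ for $4\le t\le n-1$; (2) $\sum_{t=3}^{k}(a_{2k-2t+3}-c_{2k-2t+4}+a_2\beta_{2k-2t+4})\beta_{2t-2}=0$ for $3\le k\le\lfloor\frac{n-1}{2}\rfloor$; (3) $(c_3-2a_1)\beta_{2k}=\sum_{t=3}^{k}(a_{2k-2t+4}-c_{2k-2t+5}+a_2\beta_{2k-2t+5})\beta_{2t-2}$ for $3\le k\le\lfloor\frac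 n2\rfloor-1$; (4) $(b_2-(k-2)a_1)\beta_k=\frac{k-1}{2}a_2\sum_{t=5}^{k}\beta_{t-1}\beta_{k-t+4}$ for $5\le k\le n-2$; (5) if $n$ is odd, $(b_2-c_3-(n-5)a_1)\beta_{n-1}=a_2\sum_{t=3}^{(n-1)/2}(2t-3)\beta_{n-2t+3}\beta_{2t-1}+\sum_{t=2}^{(n-3)/2}(c_{n-2t+2}-a_{n-2t+1}+(2t-3)a_2\beta_{n-2t+2})\beta_{2t}$; (6) if $n$ is even, $(b_2-(n-3)a_1)\beta_{n-1}=a_2\sum_{t=3}^{(n-2)/2}(2t-3)\beta_{n-2t+3}\beta_{2t-1}+\sum_{t=2}^{(n-2)/2}(c_{n-2t+2}-a_{n-2t+1}+(2t-3)a_2\beta_{n-2t+2})\beta_{2t}$.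
   Context: A (right) Leibniz algebra is a vector space $L$ with a bilinear bracket satisfying $[[x,y],z]=[[x,z],y]+[x,[y,z]]$ for all $x,y,z\in L$. A pre-derivation of $L$ is a linear map $P:L\to L$ with $P([[x,y],z])=[[P(x),y],z]+[[x,P(y)],z]+[[x,y],P(z)]$ for all $x,y,z\in L$. For $\beta_4,\dots,\beta_n,\gamma\in\mathbb{C}$, $F_2(\beta_4,\dots,\beta_n,\gamma)$ is the $n$-dimensional complex (filiform) Leibniz algebra with basis $e_1,\dots,e_n$ and products $[e_1,e_1]=e_3$; $[e_i,e_1]=e_{i+1}$ for $3\le i\le n-1$; $[e_1,e_2]=\sum_{t=4}^{n}\beta_te_t$; $[e_2,e_2]=\gamma e_n$; $[e_j,e_2]=\sum_{t=j+2}^{n}\beta_{t-j+2}e_t$ for $3\le j\le n-2$; all omitted products of basis elements are zero. Empty sums are zero and $\lfloor a\rfloor$ denotes the integer part of the real number $a$.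
   Formalization: The formal theorem assumes n ≥ 5 and, when n = 5, β_4 = 0: for n = 5, β_4 ≠ 0 restriction (1) is not necessary (P(e_j)=e_j for j=2,3,5, P(e_1)=P(e_4)=0 violates it), and for n ≤ 4 the restrictions mention undefined β's. *)

(* Defs.v *)
From mathcomp Require Import all_boot all_order all_algebra.
From mathcomp Require Import zify.
From mathcomp Require Import reals.
From mathcomp.real_closed Require Export complex.
Set Implicit Arguments.
Unset Strict Implicit.
Unset Printing Implicit Defensive.
Import GRing.Theory.
Local Open Scope ring_scope.

Definition leibniz_identity (L : zmodType) (br : L -> L -> L) : Prop :=
  forall x y z, br (br x y) z = br (br x z) y + br x (br y z).

Definition is_prederivation (K : fieldType) (L : lmodType K)
    (br : L -> L -> L) (P : {linear L -> L}) : Prop :=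
  forall x y z,
    P (br (br x y) z) =
      br (br (P x) y) z + br (br x (P y)) z + br (br x y) (P z).

(* The standard basis is numbered from 1: [ebase K n i] is e_i for
   1 <= i <= n, and 0 for any other i. *)
Definition ebase (K : fieldType) (n i : nat) : 'rV[K]_n :=
  \row_(j < n) (j.+1 == i)%:R.

Section F2.
Variables (K : fieldType) (n : nat) (beta : nat -> K) (gamma : K).
Local Notation e := (ebase K n).

(* [e_i, e_j]; only beta 4, ..., beta n are used. *)
Definition F2_table (i j : nat) : 'rV[K]_n :=
  if j == 1%N then
    if i == 1%N then e 3
    else if (3 <= i <= n - 1)%N then e i.+1
    else 0
  else if j == 2%N then
    if i == 1%N then \sum_(4 <= t < n.+1) beta t *: e t
    else if i == 2%N then gamma *: e n
    else if (3 <= i <= n - 2)%N then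
      \sum_(i + 2 <= t < n.+1) beta (t - i + 2)%N *: e t
    else 0
  else 0.

Definition F2_bracket (x y : 'rV[K]_n) : 'rV[K]_n :=
  \sum_(i < n) \sum_(j < n) (x 0 i * y 0 j) *: F2_table i.+1 j.+1.

Lemma F2_bracket_linearl y : linear (F2_bracket^~ y).
Proof.
move=> k u v; rewrite /F2_bracket scaler_sumr -big_split; apply: eq_bigr => i _ /=.
rewrite scaler_sumr -big_split; apply: eq_bigr => j _ /=.
by rewrite !mxE mulrDl scalerDl scalerA mulrA.
Qed.

Lemma F2_bracket_linearr x : linear (F2_bracket x).
Proof.
move=> k u v; rewrite /F2_bracket scaler_sumr -big_split; apply: eq_bigr => i _ /=.
rewrite scaler_sumr -big_split; apply: eq_bigr => j _ /=.
by rewrite !mxE mulrDr scalerDl scalerA mulrCA.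
Qed.

Lemma F2_bracket_ebase i j : (1 <= i <= n)%N -> (1 <= j <= n)%N ->
  F2_bracket (e i) (e j) = F2_table i j.
Proof.
case: i => // i; case: j => // j /= lin ljn.
rewrite /F2_bracket (bigD1 (Ordinal lin)) //= (bigD1 (Ordinal ljn)) //=.
rewrite !mxE !eqxx mulr1 scale1r !big1 ?addr0 // => [k neq_k | k neq_k].
  rewrite big1 // => l _; rewrite !mxE eqSS.
  by rewrite (negPf neq_k : (k == i :> nat) = false) mul0r scale0r.
rewrite !mxE mul1r eqSS.
by rewrite (negPf neq_k : (k == j :> nat) = false) scale0r.
Qed.

Lemma ebase_out i : (n < i)%N -> e i = 0.
Proof.
move=> lt_n_i; apply/rowP => j; rewrite !mxE.
by case: eqP => // eq_j; have := ltn_ord j; lia.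
Qed.

Let rmul (j : nat) (x : 'rV[K]_n) : 'rV[K]_n :=
  \sum_(i < n) x 0 i *: F2_table i.+1 j.

Let rmul_linear j : linear (rmul j).
Proof.
move=> k u v; rewrite /rmul scaler_sumr -big_split; apply: eq_bigr => i _ /=.
by rewrite !mxE scalerDl scalerA.
Qed.

Let rmul0 j : rmul j 0 = 0.
Proof. by rewrite /rmul big1 // => i _; rewrite mxE scale0r. Qed.

Let rmulZ j a v : rmul j (a *: v) = a *: rmul j v.
Proof.
rewrite /rmul scaler_sumr; apply: eq_bigr => i _ /=.
by rewrite !mxE scalerA.
Qed.

Let rmulD j u v : rmul j (u + v) = rmul j u + rmul j v.
Proof. by have := rmul_linear j 1 u v; rewrite !scale1r. Qed.

Let rmul_sum j (I : Type) (r : seq I) (F : I -> 'rV[K]_n) :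
  rmul j (\sum_(i <- r) F i) = \sum_(i <- r) rmul j (F i).
Proof.
elim: r => [|i r IHr]; first by rewrite !big_nil rmul0.
by rewrite !big_cons rmulD IHr.
Qed.

Let rmul_ebase j i : (1 <= i <= n)%N -> rmul j (e i) = F2_table i j.
Proof.
case: i => // i /= lin.
rewrite /rmul (bigD1 (Ordinal lin)) //= !mxE eqxx scale1r big1 ?addr0 // => k neq_k.
by rewrite !mxE eqSS (negPf neq_k : (k == i :> nat) = false) scale0r.
Qed.

Let tail (i : nat) : 'rV[K]_n :=
  \sum_(i + 2 <= t < n.+1) beta (t - i + 2)%N *: e t.

Let rmul1_ebase i : (3 <= i)%N -> rmul 1 (e i) = e i.+1.
Proof.
move=> le3i; have [lein|ltni] := leqP i n; last first.
  by rewrite !ebase_out ?rmul0 //; lia.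
rewrite rmul_ebase; last lia.
rewrite /F2_table eqxx (_ : (i == 1%N) = false); last lia.
case: ifP => // Hi; rewrite ebase_out //; lia.
Qed.

Let rmul2_ebase i : (3 <= i)%N -> rmul 2 (e i) = tail i.
Proof.
move=> le3i; have [lein|ltni] := leqP i n; last first.
  rewrite ebase_out // rmul0 /tail big_geq //; lia.
rewrite rmul_ebase; last lia.
rewrite /F2_table /= (_ : (i == 1%N) = false); last lia.
rewrite (_ : (i == 2%N) = false); last lia.
case: ifP => // Hi; rewrite /tail big_geq //; lia.
Qed.

Let rmul1_tail i : (2 <= i)%N -> rmul 1 (tail i) = tail i.+1.
Proof.
move=> le2i; rewrite /tail rmul_sum.
have [lein|ltni] := leqP (i + 2)%N n; last by rewrite !big_geq //; lia.
rewrite big_nat_recr // [RHS]big_add1 /=.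
rewrite rmulZ rmul1_ebase; last lia.
rewrite ebase_out // scaler0 addr0.
apply: eq_big_nat => t /andP[le_t _].
by rewrite rmulZ rmul1_ebase ?subSS //; lia.
Qed.

Let rmulC x : (4 <= n)%N -> rmul 1 (rmul 2 x) = rmul 2 (rmul 1 x).
Proof.
move=> n4.
have E j : rmul j x = \sum_(i < n) x 0 i *: F2_table i.+1 j by [].
rewrite !E !rmul_sum; apply: eq_bigr => i _.
rewrite !rmulZ; congr (_ *: _); have := ltn_ord i; move: (nat_of_ord i) => {}i ltin.
have [->|i1] := eqVneq i 0%N.
  rewrite /F2_table /= rmul2_ebase // -rmul1_tail // /tail; congr (rmul 1 _).
  by apply: eq_big_nat => t Ht; congr (beta _ *: _); lia.
have [->|i2] := eqVneq i 1%N.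
  rewrite /F2_table /= rmul0 rmulZ rmul1_ebase; last lia.
  by rewrite ebase_out ?scaler0.
rewrite -!rmul_ebase ?ltin // rmul1_ebase; last lia.
rewrite !rmul2_ebase; [|lia|lia].
by rewrite rmul1_tail //; lia.
Qed.

Let bracketE x y (n2 : (1 < n)%N) :
  F2_bracket x y = y 0 (Ordinal (ltnW n2)) *: rmul 1 x + y 0 (Ordinal n2) *: rmul 2 x.
Proof.
have -> : F2_bracket x y = \sum_(j < n) y 0 j *: rmul j.+1 x.
  rewrite /F2_bracket exchange_big; apply: eq_bigr => j _ /=.
  by rewrite /rmul scaler_sumr; apply: eq_bigr => i _; rewrite scalerA mulrC.
rewrite (bigD1 (Ordinal (ltnW n2))) //= (bigD1 (Ordinal n2)) //= big1 ?addr0 //.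
move=> j /andP[]; rewrite -!val_eqE /= => j0 j1.
rewrite /rmul big1 ?scaler0 // => i _; rewrite /F2_table.
by rewrite !eqSS (negPf j0) (negPf j1) scaler0.
Qed.

Let bracket_low x y (i : 'I_n) : (4 <= n)%N -> (i < 2)%N -> F2_bracket x y 0 i = 0.
Proof.
move=> n4 lti2.
have e0 t : (3 <= t)%N -> e t 0 i = 0.
  by move=> t3; rewrite mxE; case: eqP => //; lia.
have s0 m (F : nat -> K) :
    (3 <= m)%N -> (\sum_(m <= t < n.+1) F t *: e t) 0 i = 0.
  move=> m3; rewrite summxE big_nat big1 // => t /andP[le_mt _].
  by rewrite mxE e0 ?mulr0 //; lia.
rewrite /F2_bracket summxE big1 // => k _; rewrite summxE big1 // => l _.
rewrite mxE /F2_table; apply/eqP; rewrite mulf_eq0; apply/orP; right; apply/eqP.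
do ![case: ifP => ?]; rewrite ?mxE //.
- by case: eqP => //; lia.
- by case: eqP => //; lia.
- exact: s0.
- by case: eqP => [|_]; [lia | rewrite mulr0].
- by apply: (s0 _ (fun t => beta (t - k.+1 + 2)%N)); lia.
Qed.

Lemma F2_leibniz : (4 <= n)%N -> leibniz_identity F2_bracket.
Proof.
move=> n4 x y z; have n2 : (1 < n)%N by lia.
rewrite [F2_bracket x (F2_bracket y z)](bracketE _ _ n2).
rewrite !(bracket_low y z) // !scale0r !addr0 !(bracketE _ _ n2).
rewrite !rmulD !rmulZ rmulC // !scalerDr !scalerA.
rewrite (mulrC (z 0 _)) (mulrC (z 0 _)) (mulrC (z 0 _)) (mulrC (z 0 _)).
by rewrite -!addrA; congr (_ + _); rewrite addrCA.
Qed.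

End F2.

(* Main.v *)
(* The span of e_1, e_3, ..., e_n is a copy of K[X]/(X^(n-1)), with e_1 = 1 and
   e_t = X^(t-2).  On it, right multiplication by e_1 is multiplication by X
   and right multiplication by e_2 is multiplication by
   B = sum_t beta_t X^(t-2); any product of two right multiplications kills
   e_2.  A pre-derivation satisfies P(X^2 f) = X^2 P(f) + 2 X M f, where
   M = a_1 X + a_2 B, so it is determined by alpha = P(1), P(X) and P(e_2):
   up to a multiple of e_2, P(f) is D f = alpha f + M f' + delta f_odd for some
   polynomial delta.  What remains are the identities on triples involving e_2;
   they reduce to M B' + delta B_even = b_2 B mod X^(n-2) (from f = 1) and
   M B' - delta B_even = b_2 B mod X^(n-3) (from f = X), together with
   c_2 B = 0 mod X^(n-2).  Hence delta B_even and M B' - b_2 B vanish separately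
   below degree n - 3, and only their sum vanishes in degree n - 3; the
   coefficients of these identities are the restrictions (1)-(6). *)
From HB Require Import structures.
Require Import Defs.
From mathcomp Require Import all_boot all_order all_algebra.
From mathcomp Require Import zify ring.
From mathcomp Require Import reals.
From mathcomp.real_closed Require Import complex.
Import GRing.Theory.
Local Open Scope ring_scope.

(** * Polynomial preliminaries: powers of X, parity and coefficients *)

Lemma dvdXnP (K : fieldType) m (p : {poly K}) :
  'X^m %| p <-> forall i, (i < m)%N -> p`_i = 0.
Proof.
split=> [/dvdpP[q ->] i ltim|p0]; first by rewrite coefMXn ltim.
rewrite -(poly_take_drop m p) (_ : take_poly m p = 0) ?add0r ?dvdp_mull //.
by apply/polyP => i; rewrite coef_take_poly coef0; case: ifP => // /p0.
Qed.

Lemma poly_linear_ind (K : fieldType) (Q : {poly K} -> Prop) :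
    Q 0 -> (forall c p q, Q p -> Q q -> Q (c *: p + q)) ->
  (forall i, Q 'X^i) -> forall p, Q p.
Proof.
move=> Q0 QD QX p; rewrite -[p]coefK poly_def.
by elim/big_rec: _ => // i q _; apply: QD.
Qed.

Lemma coef_compNX (K : fieldType) (p : {poly K}) i :
  (p \Po - 'X)`_i = (-1) ^+ i * p`_i.
Proof.
elim/poly_linear_ind: p => [|c p q IHp IHq|j].
- by rewrite comp_poly0 coef0 mulr0.
- by rewrite comp_polyD comp_polyZ !coefD !coefZ IHp IHq; ring.
rewrite comp_Xn_poly -scaleN1r exprZn coefZ coefXn.
by case: eqP => [->|]; rewrite ?mulr0.
Qed.

Lemma coef_natrM (K : fieldType) m (p : {poly K}) i :
  (m%:R * p)`_i = m%:R * p`_i.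
Proof. by rewrite mulr_natl coefMn mulr_natl. Qed.

(** Separates the beta's by parity of index: B has coefficient beta_(j+2) in degree j, so j = 2t - 2
    carries beta_(2t) and j = 2t - 3 carries beta_(2t-1). The terms j = 0, 1 vanish in the
    applications because B starts in degree 2. *)
Lemma sum_by_parity (V : nmodType) (F : nat -> V) q :
    F 0%N = 0 -> F 1%N = 0 ->
  \sum_(j < q.+1) F j =
    \sum_(2 <= t < (q + 4)./2) F (2 * t - 2)%N
    + \sum_(3 <= t < (q + 1)./2 + 2) F (2 * t - 3)%N.
Proof.
move=> F0 F1; case: q => [|q].
  by rewrite big_ord_recr big_ord0 /= F0 !big_geq // !addr0.
elim: q => [|q IHq].
  by rewrite !big_ord_recr big_ord0 /= F0 F1 !big_geq ?addr0.
rewrite big_ord_recr [LHS]/= {}IHq; case: (boolP (odd q)) => odd_q.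
  rewrite (_ : (q.+2 + 4)./2 = (q.+1 + 4)./2); last lia.
  rewrite (_ : (q.+2 + 1)./2 + 2 = ((q.+1 + 1)./2 + 2).+1)%N; last lia.
  rewrite -addrA; congr (_ + _); rewrite [RHS]big_nat_recr; last lia.
  by congr (_ + F _); lia.
rewrite (_ : (q.+2 + 4)./2 = (q.+1 + 4)./2.+1); last lia.
rewrite (_ : (q.+2 + 1)./2 = (q.+1 + 1)./2)%N; last lia.
rewrite [in RHS]big_nat_recr; last lia.
by rewrite addrAC; congr (_ + F _ + _); lia.
Qed.

(** * The space as truncated polynomials plus the line of e_2 *)

Section Model.
Variables (K : fieldType) (n : nat).
Hypotheses (n5 : (5 <= n)%N) (two_neq0 : 2%:R != 0 :> K).
Local Notation e := (ebase K n).

(* [of_poly] sends 1 to e_1 and X^(t - 2) to e_t for t >= 3, and kills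
   X^(n - 1); e_2 is the only basis vector outside its range. *)
Definition of_poly (p : {poly K}) : 'rV[K]_n :=
  \row_j (if j == 1%N :> nat then 0 else p`_j.-1).

Lemma of_poly_is_linear : linear of_poly.
Proof.
move=> k p q; apply/rowP => j; rewrite !mxE.
by case: ifP => _; rewrite ?mulr0 ?addr0 // coefD coefZ.
Qed.

HB.instance Definition _ :=
  GRing.isLinear.Build K {poly K} 'rV[K]_n _ of_poly of_poly_is_linear.

Lemma of_poly_Xn k : of_poly 'X^k = e (if k == 0 then 1 else k + 2)%N.
Proof.
apply/rowP => j; rewrite !mxE coefXn.
case: eqP => [->|j1]; first by case: k => [|k]; rewrite ?addn2 //.
by congr _%:R; congr nat_of_bool; case: k => [|k] /=; lia.
Qed.

Lemma of_polyE p : of_poly p = of_poly p + 0 *: e 2.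
Proof. by rewrite scale0r addr0. Qed.

Lemma ebase1E : e 1 = of_poly 1.
Proof. by rewrite -(expr0 'X) of_poly_Xn. Qed.

Lemma ebase3E : e 3 = of_poly 'X.
Proof. by rewrite -['X]expr1 of_poly_Xn. Qed.

Lemma of_poly_eq0 p : of_poly p = 0 <-> 'X^(n.-1) %| p.
Proof.
rewrite dvdXnP; split=> [p0 i lti|p0]; last first.
  apply/rowP => j; rewrite !mxE; case: eqP => // j1; rewrite p0 //.
  by have := ltn_ord j; lia.
(* Degree 0 is stored at index 0 and degree i > 0 at index i + 1; index 1 belongs to e_2. *)
have lt_n : ((if i is 0 then 0 else i.+1) < n)%N by case: i lti => [|i]; lia.
have /rowP/(_ (Ordinal lt_n)) := p0; rewrite !mxE /=.
by case: i {lti lt_n}.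
Qed.

Lemma sum_ebaseE (f : nat -> K) m (j : 'I_n) :
  (\sum_(m <= t < n.+1) f t *: e t) 0 j = if (m <= j.+1)%N then f j.+1 else 0.
Proof.
rewrite summxE; case: leqP => [le_mj|lt_jm].
  rewrite (bigD1_seq j.+1) ?iota_uniq ?mem_index_iota ?le_mj ?ltnS //=.
  rewrite !mxE eqxx mulr1 big1 ?addr0 // => t /negPf neq_t.
  by rewrite !mxE eq_sym neq_t mulr0.
rewrite big_nat big1 // => t /andP[le_mt _].
by rewrite !mxE (_ : (j.+1 == t) = false) ?mulr0 //; lia.
Qed.

(** Generating polynomial of f m, f (m + 1), ...; one cutoff serves every offset, since [of_poly]
    kills the degrees from n - 1 on. *)
Definition tail_poly m (f : nat -> K) : {poly K} := \poly_(j < n) f (j + m)%N.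

Lemma sum_ebase (f : nat -> K) :
  \sum_(1 <= t < n.+1) f t *: e t =
    of_poly ((f 1%N)%:P + 'X * tail_poly 3 f) + f 2%N *: e 2.
Proof.
apply/rowP => j; rewrite sum_ebaseE !mxE coefD coefC coefXM coef_poly /=.
have ltjn := ltn_ord j; case: (nat_of_ord j) ltjn => [|[|i]] lti /=.
- by rewrite !addr0 mulr0 addr0.
- by rewrite add0r mulr1.
by rewrite (_ : i < n)%N ?mulr0 ?addr0 ?add0r ?addn3 //; lia.
Qed.

(** Numbered from 1 and total on nat, so that the coordinates of P(e_1) and P(e_3) can serve as the
    families a and c. *)
Definition coordinate (v : 'rV[K]_n) (t : nat) : K := oapp (v 0) 0 (insub t.-1).

Lemma coordinateE v : v = \sum_(1 <= t < n.+1) coordinate v t *: e t.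
Proof. by apply/rowP => j; rewrite sum_ebaseE /coordinate /= valK. Qed.

Lemma of_poly_decomp v : exists p s, v = of_poly p + s *: e 2.
Proof. by rewrite [v]coordinateE sum_ebase; do 2!eexists. Qed.

Lemma Xn_pred : 'X^(n.-1) = 'X * 'X^(n - 2) :> {poly K}.
Proof. by rewrite -exprS; congr ('X^_); lia. Qed.

Lemma Xn_sub2 : 'X^(n - 2) = 'X * 'X^(n - 3) :> {poly K}.
Proof. by rewrite -exprS; congr ('X^_); lia. Qed.

Lemma Xn_sub3 : 'X^(n - 3) %| ('X^(n - 2) : {poly K}).
Proof. by rewrite Xn_sub2 dvdp_mull. Qed.

(** * The bracket in the polynomial model *)

Section Bracket.
Variables (beta : nat -> K) (gamma : K).
Local Notation br := (F2_bracket (n := n) beta gamma).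

Definition structure_poly : {poly K} := 'X^2 * tail_poly 4 beta.
Local Notation B := structure_poly.

Definition right_mul y x := br x y.

HB.instance Definition _ y := GRing.isLinear.Build K 'rV[K]_n 'rV[K]_n _
  (right_mul y) (F2_bracket_linearl beta gamma y).
HB.instance Definition _ x := GRing.isLinear.Build K 'rV[K]_n 'rV[K]_n _
  (F2_bracket beta gamma x) (F2_bracket_linearr beta gamma x).

Lemma bracket_ebase_out u k : (3 <= k)%N -> br u (e k) = 0.
Proof.
move=> k3; rewrite /F2_bracket big1 // => i _; rewrite big1 // => j _.
rewrite mxE; case: eqP => [jk|]; last by rewrite mulr0 scale0r.
by rewrite /F2_table jk; case: k k3 jk => [|[|[|k]]] //; rewrite scaler0.
Qed.

(** The rules [e_1, e_1] = e_3 and [e_i, e_1] = e_(i+1) become a single one, and [e_n, e_1] = 0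
    becomes the vanishing of X^(n-1). *)
Lemma bracket_poly1 p : br (of_poly p) (e 1) = of_poly (p * 'X).
Proof.
rewrite -/(right_mul (e 1) _); elim/poly_linear_ind: p => [|c p q IHp IHq|k].
- by rewrite mul0r !linear0.
- by rewrite mulrDl -scalerAl !linearP /= IHp IHq.
rewrite -exprSr !of_poly_Xn /right_mul /=.
have [lekn|ltnk] := leqP (k + 2) n; last first.
  have k0 : (k == 0 = false)%N by lia.
  rewrite k0 -/(right_mul _ _) [e (k + 2)]ebase_out ?linear0 //.
  by rewrite ebase_out //; lia.
rewrite F2_bracket_ebase; [|by case: k lekn => [|k] /=; lia|lia].
rewrite /F2_table /=; case: k lekn => [|k] //= lekn.
rewrite (_ : (k.+1 + 2 == 1)%N = false); last lia.
case: ifP => [_|k3]; first by congr e; lia.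
by rewrite ebase_out //; lia.
Qed.

(** Covers the sum for [e_1, e_2] at k = 0 and the one for [e_j, e_2] at k = j - 2. *)
Lemma of_poly_XnM k :
  of_poly ('X^k * B) = \sum_(k + 4 <= t < n.+1) beta (t - k)%N *: e t.
Proof.
apply/rowP => j; rewrite sum_ebaseE mxE /structure_poly mulrA -exprD coefXnM.
rewrite coef_poly; have := ltn_ord j.
case: ifP => [/eqP -> _|j1 ltjn].
  by rewrite (_ : (k + 4 <= 2)%N = false) //; lia.
case: ifP; case: ifP => //; try lia.
move=> ? ?; rewrite ifT; last lia.
by congr beta; lia.
Qed.

Lemma bracket_poly2 p : br (of_poly p) (e 2) = of_poly (p * B).
Proof.
rewrite -/(right_mul (e 2) _); elim/poly_linear_ind: p => [|c p q IHp IHq|k].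
- by rewrite mul0r !linear0.
- by rewrite mulrDl -scalerAl !linearP /= IHp IHq.
rewrite of_poly_XnM of_poly_Xn /right_mul /=.
have [lekn|ltnk] := leqP (k + 2) n; last first.
  have k0 : (k == 0 = false)%N by lia.
  rewrite k0 -/(right_mul _ _) [e (k + 2)]ebase_out ?linear0 //.
  by rewrite big_geq //; lia.
rewrite F2_bracket_ebase; [|by case: k lekn => [|k] /=; lia|lia].
rewrite /F2_table /=; case: k lekn => [|k] //= lekn.
  by apply: eq_big_nat => t _; rewrite subn0.
rewrite (_ : (k.+1 + 2 == 1)%N = false); last lia.
rewrite (_ : (k.+1 + 2 == 2)%N = false); last lia.
case: ifP => [_|k3]; last by rewrite big_geq //; lia.
rewrite -!addnA; apply: eq_big_nat => t /andP[? _]; congr (beta _ *: _); lia.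
Qed.

(** Every e_k with k >= 3 annihilates from the right, so only the constant coefficient acts. *)
Lemma bracket_polyr x q : br x (of_poly q) = q`_0 *: br x (e 1).
Proof.
elim/poly_linear_ind: q => [|c p q IHp IHq|k].
- by rewrite linear0 coef0 scale0r linear0.
- by rewrite !linearP /= IHp IHq coefD coefZ scalerDl scalerA.
rewrite of_poly_Xn coefXn; case: k => [|k]; first by rewrite scale1r.
by rewrite scale0r bracket_ebase_out //= addn2.
Qed.

(** The polynomial by which right multiplication by [of_poly q + r *: e 2] acts on polynomials. *)
Definition right_poly (q : {poly K}) r : {poly K} := q`_0 *: 'X + r *: B.

Definition right_quot (q : {poly K}) r : {poly K} :=
  (q`_0)%:P + r *: ('X * tail_poly 4 beta).

Lemma right_polyE q r : right_poly q r = 'X * right_quot q r.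
Proof.
by rewrite /right_poly /right_quot /structure_poly -!mul_polyC; ring.
Qed.

Lemma right_poly1 : right_poly 1 0 = 'X.
Proof. by rewrite /right_poly coef1 scale1r scale0r addr0. Qed.

Lemma bracketE p s q r :
  br (of_poly p + s *: e 2) (of_poly q + r *: e 2) =
    of_poly (p * right_poly q r + (s * r * gamma) *: 'X^(n - 2)).
Proof.
have e2r j : br (of_poly p + s *: e 2) (e j) =
    br (of_poly p) (e j) + s *: br (e 2) (e j).
  by rewrite -/(right_mul (e j) _) linearD linearZ.
rewrite linearD linearZ /= bracket_polyr !e2r bracket_poly1 bracket_poly2.
rewrite !F2_bracket_ebase; try lia.
rewrite /F2_table /= scaler0 addr0 /right_poly mulrDr -!scalerAr.
rewrite !linearD !linearZ /= of_poly_Xn (_ : (n - 2 == 0)%N = false); last lia.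
rewrite subnK; last lia.
by rewrite !scalerA addrA mulrAC.
Qed.

(** The gamma term of the inner bracket lies in the top degree n - 2, and the outer multiplier is
    divisible by X; hence neither gamma nor the e_2-component s survives in a triple product. *)
Lemma bracket3E p s q r q' r' :
  br (br (of_poly p + s *: e 2) (of_poly q + r *: e 2))
     (of_poly q' + r' *: e 2) =
    of_poly (p * right_poly q r * right_poly q' r').
Proof.
rewrite bracketE -[of_poly (_ + _)]addr0 -(scale0r (e 2)) bracketE.
rewrite !mul0r scale0r addr0 mulrDl linearD /=.
rewrite [X in _ + X](_ : _ = 0) ?addr0 //.
apply/of_poly_eq0; rewrite right_polyE.
rewrite Xn_pred mulrA [_ * 'X]mulrC -scalerAr dvdp_mulr //.
by rewrite -mul_polyC dvdp_mull.
Qed.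

(** * Pre-derivations as twisted derivations of polynomials *)

Section Prederivation.
Variables (a c : nat -> K) (b2 : K).
Local Notation B2 := (tail_poly 4 beta).
Local Notation "p ^-" := (p \Po - 'X) (at level 2, format "p ^-").

Definition image1_poly : {poly K} := (a 1)%:P + 'X * tail_poly 3 a.
Local Notation A := image1_poly.

(* [shift_quot] is M / X, where M = a_1 X + a_2 B is the polynomial by which
   right multiplication by P(e_1) acts. *)
Definition shift_quot : {poly K} := (a 1)%:P + (a 2)%:P * ('X * B2).
Local Notation M := ('X * shift_quot).

(* With alpha and kappa the polynomials of P(e_1) and P(e_3), this is
   kappa / X - alpha - M / X: the failure on odd powers of X of the rule
   P(f) = alpha f + M f' that holds on even powers. *)
Definition defect_poly : {poly K} :=
  tail_poly 3 c - (a 1 *+ 2)%:P - 'X * (tail_poly 3 a + (a 2)%:P * B2).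

(** Halved because [p - p^-] is twice the odd part of p. Expressing the odd part through the ring
    morphism X -> -X lets [ring] handle products. *)
Definition half_defect : {poly K} := 2%:R^-1 *: defect_poly.
Local Notation h := half_defect.

Definition twisted_derivation (p : {poly K}) : {poly K} :=
  A * p + M * p^`() + h * (p - p^-).
Local Notation D := twisted_derivation.

Lemma half_defectD : h + h = defect_poly.
Proof. by rewrite -mulr2n -scaler_nat scalerA divff // scale1r. Qed.

Lemma twisted_derivation_is_linear : linear D.
Proof.
move=> k p q; rewrite /D derivD derivZ comp_polyD comp_polyZ -!mul_polyC.
ring.
Qed.

HB.instance Definition _ :=
  GRing.isLinear.Build K {poly K} {poly K} _ D twisted_derivation_is_linear.

Lemma twisted_derivation1 : D 1 = A.
Proof. by rewrite /D derivC comp_polyC subrr; ring. Qed.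

Lemma twisted_derivationX : D 'X = 'X * tail_poly 3 c.
Proof.
rewrite /D derivX comp_polyX opprK (_ : h * _ = (h + h) * 'X); last by ring.
rewrite half_defectD.
by rewrite /defect_poly /A /shift_quot rmorphMn /=; ring.
Qed.

(** Multiplication by X^2 preserves parity, so the odd-part term only scales and the correction
    comes from M (X^2)' = 2 X M. *)
Lemma twisted_derivationXX p :
  D ('X * 'X * p) = 'X * 'X * D p + ('X *+ 2) * M * p.
Proof.
by rewrite /D !derivM derivX !comp_polyM comp_polyX; ring.
Qed.

Lemma twisted_derivation_coef0 p : (D p)`_0 = a 1 * p`_0.
Proof.
rewrite /D !coefD !coef0M coefB coef_compNX !coefD !coefC coef0M coefX.
by rewrite /=; ring.
Qed.

(** Delta times the even part of B. It is the even part that enters because two right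
    multiplications occur in the identity, and the odd part of X B is X times the even part of B. *)
Definition even_obstruction := h * (B + B^-).
Definition derivation_obstruction := M * B^`() - b2 *: B.
Local Notation G := even_obstruction.
Local Notation H := derivation_obstruction.

Lemma twisted_derivationM p f :
  D (p * f) - D p * f = M * p * f^`() + h * p^- * (f - f^-).
Proof. by rewrite /D derivM comp_polyM; ring. Qed.

Lemma twisted_derivation_even m :
  D 'X^(2 * m) = 'X^(2 * m) * (A + (2 * m)%:R * shift_quot).
Proof.
elim: m => [|m IHm]; first by rewrite muln0 expr0 twisted_derivation1; ring.
have -> : 'X^(2 * m.+1) = 'X * 'X * 'X^(2 * m) :> {poly K}.
  by rewrite mulnS exprD expr2.
by rewrite twisted_derivationXX IHm; ring.
Qed.

Lemma twisted_derivation_odd m :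
  D 'X^(2 * m + 1) = 'X^(2 * m + 1) * (tail_poly 3 c + (2 * m)%:R * shift_quot).
Proof.
elim: m => [|m IHm].
  by rewrite muln0 add0n expr1 twisted_derivationX; ring.
have -> : 'X^(2 * m.+1 + 1) = 'X * 'X * 'X^(2 * m + 1) :> {poly K}.
  by rewrite mulnS -addnA exprD expr2.
by rewrite twisted_derivationXX IHm; ring.
Qed.

Lemma form_e3 :
  \sum_(2 <= t < n.+1) c t *: e t = of_poly (D 'X) + c 2 *: e 2.
Proof.
rewrite twisted_derivationX; apply/rowP => j; rewrite sum_ebaseE !mxE coefXM.
rewrite coef_poly; have := ltn_ord j; case: (nat_of_ord j) => [|[|i]] lti /=.
- by rewrite mulr0 addr0.
- by rewrite add0r mulr1.
by rewrite ifT ?mulr0 ?addr0 ?addn3 //; lia.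
Qed.

(** Here e_(2i) is X^(2i-2); the diagonal coefficient adds a_1 from alpha to (2i - 2) a_1 from M
    f'. *)
Lemma form_even i : (2 <= i)%N ->
  ((2 * i - 1)%:R * a 1%N) *: e (2 * i)%N
    + \sum_(2 * i + 1 <= t < n.+1)
        (a (t - 2 * i + 2)%N
         + (2 * i - 2)%:R * a 2%N * beta (t - 2 * i + 3)%N) *: e t
  = of_poly (D 'X^(2 * (i - 1))).
Proof.
move=> i2; rewrite twisted_derivation_even; apply/rowP => j.
rewrite !mxE (sum_ebaseE (fun t => a (t - 2 * i + 2)%N +
  (2 * i - 2)%:R * a 2%N * beta (t - 2 * i + 3)%N)) coefXnM.
have ltjn := ltn_ord j; case: (eqVneq (nat_of_ord j) 1%N) => [->|j1].
  have -> : (2 == 2 * i)%N = false by lia.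
  by rewrite ifF ?mulr0 ?addr0 //; lia.
case: (ltnP j.-1) => [lt_ji|le_ij].
  have -> : (j.+1 == 2 * i)%N = false by lia.
  by rewrite ifF ?mulr0 ?addr0 //; lia.
rewrite (_ : (j.-1 - 2 * (i - 1) = j.+1 - 2 * i)%N); last lia.
have /subnKC : (2 * i <= j.+1)%N by lia.
have : (j.+1 - 2 * i < n)%N by lia.
move: (_ - _)%N => k ltkn <-.
rewrite !coefD coef_natrM coefD coefCM !coefXM !coefC.
case: k ltkn => [|k] ltkn /=.
  rewrite addn0 eqxx ifF ?mulr0 ?addr0 ?mulr1; last lia.
  by rewrite -[X in X + _]mul1r -mulrDl nat1r; congr (_%:R * _); lia.
have -> : (2 * i + k.+1 == 2 * i)%N = false by lia.
have -> : (2 * i + 1 <= 2 * i + k.+1)%N by lia.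
rewrite mulr0 !add0r !coef_poly !(ltnW ltkn).

by rewrite !addSnnS mulrA (_ : (2 * (i - 1) = 2 * i - 2)%N) //; lia.
Qed.

Lemma form_odd i : (2 <= i)%N ->
  ((2 * i - 2)%:R * a 1%N + c 3%N) *: e (2 * i + 1)%N
    + \sum_(2 * i + 2 <= t < n.+1)
        (c (t - 2 * i + 2)%N
         + (2 * i - 2)%:R * a 2%N * beta (t - 2 * i + 2)%N) *: e t
  = of_poly (D 'X^(2 * (i - 1) + 1)).
Proof.
move=> i2; rewrite twisted_derivation_odd; apply/rowP => j.
rewrite !mxE (sum_ebaseE (fun t => c (t - 2 * i + 2)%N +
  (2 * i - 2)%:R * a 2%N * beta (t - 2 * i + 2)%N)) coefXnM.
have ltjn := ltn_ord j; case: (eqVneq (nat_of_ord j) 1%N) => [->|j1].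
  have -> : (2 == 2 * i + 1)%N = false by lia.
  by rewrite ifF ?mulr0 ?addr0 //; lia.
case: (ltnP j.-1) => [lt_ji|le_ij].
  have -> : (j.+1 == 2 * i + 1)%N = false by lia.
  by rewrite ifF ?mulr0 ?addr0 //; lia.
rewrite (_ : (j.-1 - (2 * (i - 1) + 1) = j.+1 - (2 * i + 1))%N); last lia.
have /subnKC : (2 * i + 1 <= j.+1)%N by lia.
have : (j.+1 - (2 * i + 1) < n)%N by lia.
move: (_ - _)%N => k ltkn <-.
rewrite !coefD coef_natrM coefD coefCM !coefXM !coefC.
rewrite coef_poly ltkn (_ : (2 * (i - 1) = 2 * i - 2)%N); last lia.
case: k ltkn => [|k] ltkn /=.
  by rewrite addn0 eqxx ifF ?mulr0 ?addr0 ?mulr1 1?addrC //; lia.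
have -> : (2 * i + 1 + k.+1 == 2 * i + 1)%N = false by lia.
have -> : (2 * i + 2 <= 2 * i + 1 + k.+1)%N by lia.
rewrite mulr0 !add0r !coef_poly (ltnW ltkn).
rewrite (_ : (2 * i + 1 + k.+1 - 2 * i = k.+2)%N); last lia.
by rewrite mulrA !addnS !addn0.
Qed.

Lemma e2_coef_Xn k : (2 <= k)%N ->
  (a 2 * ('X^k)`_0 + c 2 * ('X^k)`_1) *: e 2 = 0.
Proof. by case: k => [|[|k]] // _; rewrite !coefXn !mulr0 addr0 scale0r. Qed.

Lemma poly_image_monomials (P : {linear 'rV[K]_n -> 'rV[K]_n}) :
    (forall k, (k < n.-1)%N -> P (of_poly 'X^k) =
      of_poly (D 'X^k) + (a 2 * ('X^k)`_0 + c 2 * ('X^k)`_1) *: e 2) ->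
  forall p, P (of_poly p) = of_poly (D p) + (a 2 * p`_0 + c 2 * p`_1) *: e 2.
Proof.
move=> Pk p; elim/poly_linear_ind: p => [|s p q IHp IHq|k].
- by rewrite [D 0]linear0 !linear0 !coef0 !mulr0 addr0 scale0r addr0.
- rewrite !linearP /= IHp IHq !coefD !coefZ scalerDr addrACA scalerA -scalerDl.
  by congr (_ + _ *: _); ring.
have [/Pk //|le_nk] := ltnP k n.-1.
(* From degree n - 1 on both sides vanish: X^k is killed, and D X^k is a multiple of X^k by the
   formulas for even and odd powers. *)
have X0 : of_poly 'X^k = 0 by apply/of_poly_eq0/dvdp_exp2l.
rewrite X0 linear0 e2_coef_Xn ?addr0; last lia.
apply/esym/of_poly_eq0; apply: dvdp_trans (dvdp_exp2l 'X le_nk) _.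
rewrite -(odd_double_half k) addnC -mul2n; case: (odd k) => /=.
  by rewrite twisted_derivation_odd dvdp_mulr.
by rewrite addn0 twisted_derivation_even dvdp_mulr.
Qed.

Lemma formsP (P : {linear 'rV[K]_n -> 'rV[K]_n}) :
  (forall p,
     P (of_poly p) = of_poly (D p) + (a 2 * p`_0 + c 2 * p`_1) *: e 2) <->
  P (e 1%N) = \sum_(1 <= t < n.+1) a t *: e t /\
  P (e 3%N) = \sum_(2 <= t < n.+1) c t *: e t /\
  (forall i : nat, (2 <= i <= n./2)%N ->
     P (e (2 * i)%N) =
       ((2 * i - 1)%:R * a 1%N) *: e (2 * i)%N
       + \sum_(2 * i + 1 <= t < n.+1)
           (a (t - 2 * i + 2)%N
            + (2 * i - 2)%:R * a 2%N * beta (t - 2 * i + 3)%N) *: e t) /\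
  (forall i : nat, (2 <= i <= n.-1./2)%N ->
     P (e (2 * i + 1)%N) =
       ((2 * i - 2)%:R * a 1%N + c 3%N) *: e (2 * i + 1)%N
       + \sum_(2 * i + 2 <= t < n.+1)
           (c (t - 2 * i + 2)%N
            + (2 * i - 2)%:R * a 2%N * beta (t - 2 * i + 2)%N) *: e t).
Proof.
have even_e i : (2 <= i)%N -> e (2 * i) = of_poly 'X^(2 * (i - 1)).
  by move=> i2; rewrite of_poly_Xn ifF; [congr e; lia | lia].
have odd_e i : (2 <= i)%N -> e (2 * i + 1) = of_poly 'X^(2 * (i - 1) + 1).
  by move=> i2; rewrite of_poly_Xn ifF; [congr e; lia | lia].
rewrite ebase1E ebase3E form_e3 sum_ebase -/image1_poly -twisted_derivation1.
split=> [Pp | [P1 [P3 [Peven Podd]]]].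
  split; first by rewrite Pp !coef1 mulr1 mulr0 addr0.
  split; first by rewrite Pp !coefX mulr1 mulr0 add0r.
  split=> i /andP[i2 _].
    by rewrite form_even // even_e // Pp e2_coef_Xn ?addr0 //; lia.
  by rewrite form_odd // odd_e // Pp e2_coef_Xn ?addr0 //; lia.
apply: poly_image_monomials => -[|[|k]] lt_kn.
- by rewrite expr0 P1 !coef1 mulr1 mulr0 addr0.
- by rewrite expr1 P3 !coefX mulr1 mulr0 add0r.
rewrite !coefXn /= !mulr0 addr0 scale0r addr0.
have := odd_double_half k; rewrite -mul2n; case: (odd k) => /= Ek.
  have -> : k.+2 = (2 * (k./2.+2 - 1) + 1)%N by lia.
  by rewrite -odd_e ?Podd ?form_odd //; lia.
have -> : k.+2 = (2 * (k./2.+2 - 1))%N by lia.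
by rewrite -even_e ?Peven ?form_even //; lia.
Qed.

(** Induction in steps of two: the triple (X^k, e_1, e_1) gives for P the recursion
    [twisted_derivationXX] of D, so agreement on 1 and X propagates. Triple products have no
    e_2-component, which settles that coordinate for k >= 2. *)
Lemma prederivation_poly_image (P : {linear 'rV[K]_n -> 'rV[K]_n}) :
    is_prederivation br P ->
    P (of_poly 1) = of_poly (D 1) + a 2 *: e 2 ->
    P (of_poly 'X) = of_poly (D 'X) + c 2 *: e 2 ->
  forall p, P (of_poly p) = of_poly (D p) + (a 2 * p`_0 + c 2 * p`_1) *: e 2.
Proof.
move=> derP P1 P3; apply: poly_image_monomials => k _.
elim/ltn_ind: k => -[|[|k]] IHk.
- by rewrite expr0 P1 !coef1 mulr1 mulr0 addr0.
- by rewrite expr1 P3 !coefX mulr1 mulr0 add0r.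
have XX p : of_poly ('X * 'X * p) = br (br (of_poly p) (e 1)) (e 1).
  by rewrite !bracket_poly1 mulrC mulrA.
rewrite e2_coef_Xn // addr0 -addn2 addnC exprD expr2 XX derP IHk // ebase1E P1.
rewrite (of_polyE 1) (of_polyE 'X^k) !bracket3E -!linearD twisted_derivation1.
rewrite twisted_derivationXX right_poly1 /=; congr of_poly.
have -> : right_poly A (a 2) = M.
  rewrite right_polyE /right_quot /A coefD coefC coefXM addr0 /shift_quot.
  by rewrite mul_polyC.
by ring.
Qed.

(** * The pre-derivation identity as divisibility conditions *)

Section Map.
Variables (P : {linear 'rV[K]_n -> 'rV[K]_n}) (r : {poly K}).
Hypothesis P_poly : forall p,
  P (of_poly p) = of_poly (D p) + (a 2 * p`_0 + c 2 * p`_1) *: e 2.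
Hypothesis P_e2 : P (e 2) = of_poly r + b2 *: e 2.
Hypothesis Xr : 'X^(n - 3) %| r.

(** Sorted by the product of multipliers involved: X B, then B^2, then the corrections due to the
    e_2-components that c_2 adds to the images of the second and third arguments. The X^2 terms
    cancel by the recursion for D. *)
Definition prederivation_defect p q s q' s' : {poly K} :=
  let m := right_poly q s in let m' := right_poly q' s' in
  (q`_0 * s' + s * q'`_0) *: ('X * (p * H + p^- * G))
  + (s * s') *: (B * ((p * H) *+ 2 + p^- * G) - B^- * (p^- * G))
  - (c 2 * q`_1) *: (p * B * m') - (c 2 * q'`_1) *: (p * B * m).

Lemma r_coef0 : r`_0 = 0.
Proof. by move/dvdXnP: Xr => -> //; lia. Qed.

Lemma map_pair p s : P (of_poly p + s *: e 2) =
  of_poly (D p + s *: r) + (a 2 * p`_0 + c 2 * p`_1 + s * b2) *: e 2.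
Proof.
rewrite linearD /= linearZ /= P_poly P_e2 scalerDr scalerA.
rewrite [of_poly (_ + _)]linearD /= [of_poly (_ *: _)]linearZ.
by rewrite [(_ + s * b2) *: _]scalerDl addrACA.
Qed.

Lemma right_poly_image q s : 
  right_poly (D q + s *: r) (a 2 * q`_0 + c 2 * q`_1 + s * b2) =
  q`_0 *: M + (s * b2) *: B + (c 2 * q`_1) *: B.
Proof.
rewrite /right_poly coefD coefZ r_coef0 twisted_derivation_coef0 mulr0 addr0.
by rewrite /shift_quot /structure_poly -!mul_polyC !(polyCD, polyCM); ring.
Qed.

Lemma prederivation_defectE p s q t q' t' :
  let u := of_poly p + s *: e 2 in
  let v := of_poly q + t *: e 2 in
  let w := of_poly q' + t' *: e 2 in
  P (br (br u v) w)
    - (br (br (P u) v) w + br (br u (P v)) w + br (br u v) (P w)) =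
  of_poly (prederivation_defect p q t q' t').
Proof.
move=> u v w; rewrite /u /v /w !map_pair !bracket3E P_poly !right_poly_image.
set m := right_poly q t; set m' := right_poly q' t'.
(* Each multiplier is divisible by X, so degrees 0 and 1 are empty and the image has no
   e_2-component. *)
have mmE : p * m * m' = 'X^2 * (p * right_quot q t * right_quot q' t').
  by rewrite /m /m' !right_polyE; ring.
have -> : (p * m * m')`_0 = 0 by rewrite mmE coefXnM.
have -> : (p * m * m')`_1 = 0 by rewrite mmE coefXnM.
rewrite !mulr0 addr0 scale0r addr0 -!linearD -linearB /=.
(* X^(n-3) divides r and X divides each multiplier, so r disappears from the identity. *)
have r0 : of_poly (s *: r * m * m') = 0.
  apply/of_poly_eq0; rewrite /m /m' !right_polyE.
  have -> : 'X^(n.-1) = 'X^(n - 3) * 'X^2 :> {poly K}.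
    by rewrite Xn_pred Xn_sub2; ring.
  rewrite (_ : s *: r * _ * _ =
    r * 'X^2 * (s%:P * right_quot q t * right_quot q' t')); last first.
    by rewrite -mul_polyC; ring.
  by rewrite dvdp_mulr // dvdp_mul.
rewrite -[RHS]subr0 -r0 -linearB /=; congr of_poly.
rewrite -[p * m * m']mulrA.
have -> : D (p * (m * m')) =
   D p * (m * m') + (M * p * (m * m')^`() + h * p^- * (m * m' - (m * m')^-)).
  by rewrite -twisted_derivationM addrC subrK.
rewrite comp_polyM !derivM /prederivation_defect -/m -/m' /G /H.
have -> : m^`() = (q`_0)%:P + t%:P * B^`().
  by rewrite /m /right_poly derivD !derivZ derivX -!mul_polyC mulr1.
have -> : m'^`() = (q'`_0)%:P + t'%:P * B^`().
  by rewrite /m' /right_poly derivD !derivZ derivX -!mul_polyC mulr1.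
have -> : m^- = - (q`_0)%:P * 'X + t%:P * B^-.
  by rewrite /m /right_poly comp_polyD !comp_polyZ comp_polyX -!mul_polyC; ring.
have -> : m'^- = - (q'`_0)%:P * 'X + t'%:P * B^-.
  rewrite /m' /right_poly comp_polyD !comp_polyZ comp_polyX -!mul_polyC.
  by ring.
rewrite /m /m' /right_poly -!mul_polyC !(polyCM, polyCD).
move: B B^- B^`() (D p) => B0 B1 B3 Dp.
ring.
Qed.

Lemma dvdp_X_subN (p : {poly K}) : 'X %| p^- - p.
Proof.
rewrite -['X]expr1; apply/dvdXnP => i; rewrite ltnS leqn0 => /eqP ->.
by rewrite coefB coef_compNX mul1r subrr.
Qed.

Lemma prederivationP : is_prederivation br P <->
  [/\ 'X^(n - 2) %| c 2 *: B, 'X^(n - 2) %| H + G & 'X^(n - 3) %| H - G].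
Proof.
split=> [derP | [cB HG HmG] x y z].
  have dvd_defect p q s q' s' : 'X^(n.-1) %| prederivation_defect p q s q' s'.
    apply/of_poly_eq0; rewrite -(prederivation_defectE p 0 q s q' s') derP.
    exact: subrr.
  split.
  (* The triples (e_1, e_3, e_1), (e_1, e_1, e_2) and (e_3, e_1, e_2) isolate the three conditions
     in turn. In the last, X -> -X reverses the sign of G, and the additional factor X lowers the
     exponent to n - 3. *)
  - have := dvd_defect 1 'X 0 1 0.
    rewrite /prederivation_defect /right_poly !coefX !coef1 /=.
    rewrite !mulr0 !mul0r !scale0r.
    rewrite !(add0r, addr0, subr0, mul1r, mulr0, mulr1, scaler0, scale1r).
    rewrite scale0r sub0r Xn_pred dvdpNr scalerAl [_ *: _ * _]mulrC.
    by rewrite dvdp_mul2l ?polyX_eq0.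
  - have := dvd_defect 1 1 0 0 1.
    rewrite /prederivation_defect /right_poly !coef0 !coef1 /=.
    rewrite !mulr0 !mul0r !scale0r.
    rewrite !(add0r, addr0, subr0, mul1r, mulr0, mulr1, scale1r, comp_polyC).
    by rewrite Xn_pred dvdp_mul2l ?polyX_eq0.
  have := dvd_defect 'X 1 0 0 1.
  rewrite /prederivation_defect /right_poly !coef0 !coef1 /=.
  rewrite !mulr0 !mul0r !scale0r.
  rewrite !(add0r, addr0, subr0, mul1r, mulr0, mulr1, scale1r, comp_polyX).
  rewrite mulNr -mulrBr Xn_pred dvdp_mul2l ?polyX_eq0 //.
  by rewrite Xn_sub2 dvdp_mul2l ?polyX_eq0.
have [p [s ->]] := of_poly_decomp x.
have [q [t ->]] := of_poly_decomp y.
have [q' [t' ->]] := of_poly_decomp z.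
apply/eqP; rewrite -subr_eq0 prederivation_defectE; apply/eqP/of_poly_eq0.
have dvd2 (f : {poly K}) : ('X^(n - 3) %| f *+ 2) = ('X^(n - 3) %| f).
  by rewrite -scaler_nat dvdpZr.
have dvdG : 'X^(n - 3) %| G.
  rewrite -dvd2 (_ : G *+ 2 = (H + G) - (H - G)); last by ring.
  by rewrite dvdp_sub // (dvdp_trans Xn_sub3).
have dvdH : 'X^(n - 3) %| H.
  by rewrite -[H](subrK G) dvdp_add.
have cBm f g u : 'X^(n.-1) %| (c 2 * u) *: (f * B * right_poly g.1 g.2).
  rewrite right_polyE (_ : _ *: _ =
    'X * ((c 2 *: B) * (u%:P * f * right_quot g.1 g.2))).
    by rewrite Xn_pred dvdp_mul // dvdp_mulr.
  by rewrite -!mul_polyC polyCM; ring.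
rewrite /prederivation_defect.
apply: dvdp_sub; last exact: (cBm _ (_, _)).
apply: dvdp_sub; last exact: (cBm _ (_, _)).
apply: dvdp_add; rewrite -mul_polyC dvdp_mull //.
  rewrite Xn_pred dvdp_mul2l ?polyX_eq0 //.
  (* G alone is divisible only by X^(n-3); the missing X comes from [p^- - p], which has no constant
     term. *)
  rewrite (_ : p * H + _ = p * (H + G) + (p^- - p) * G); last by ring.
  apply: dvdp_add; first exact: dvdp_mull.
  by rewrite Xn_sub2 dvdp_mul // dvdp_X_subN.
(* B and B(-X) both contain X^2, so divisibility of G and H by X^(n-3) suffices here. *)
rewrite Xn_pred Xn_sub2 mulrA -expr2.
rewrite /structure_poly comp_polyM comp_Xn_poly sqrrN.
have dvdpG : 'X^(n - 3) %| p^- * G by rewrite dvdp_mull.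
rewrite -!(mulrA 'X^2) dvdp_sub // dvdp_mul ?dvdpp // dvdp_mull //.
by rewrite dvdp_add // dvd2 dvdp_mull.
Qed.

End Map.

(** * Coefficients of the obstructions *)

Lemma coef_structure_poly j : (j < n)%N ->
  B`_j = if (j < 2)%N then 0 else beta (j + 2)%N.
Proof.
move=> ltjn; rewrite coefXnM coef_poly; case: ltnP => // le2j.
by rewrite ifT; [congr beta|]; lia.
Qed.

Lemma coef_defect0 : defect_poly`_0 = c 3 - 2%:R * a 1.
Proof.
by rewrite !coefB coefC coefXM coef_poly /= subr0 mulr_natl ifT //; lia.
Qed.

Lemma coef_defectS j : (j.+1 < n)%N ->
  defect_poly`_j.+1 = c (j + 4)%N - a (j + 3)%N - a 2 * beta (j + 4)%N.
Proof.
move=> ltjn; rewrite !coefB coefC coefXM /= coefD coefCM !coef_poly.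
rewrite ltjn (ltnW ltjn).
by rewrite addSnnS; ring.
Qed.

(** A convolution of delta with the even part of B, which carries beta_(2t) in degree 2t - 2. *)
Lemma coef_even_obstruction q : (q < n)%N ->
  G`_q =
    \sum_(2 <= t < (q + 4)./2) defect_poly`_(q + 2 - 2 * t) * beta (2 * t)%N.
Proof.
move=> ltqn.
have -> : G = defect_poly * (2%:R^-1 *: (B + B^-)).
  by rewrite /G /half_defect -scalerAl -scalerAr.
have coefE j : (j < n)%N -> (2%:R^-1 *: (B + B^-))`_j =
    if (j < 2)%N || odd j then 0 else beta (j + 2)%N.
  move=> ltjn; rewrite coefZ coefD coef_compNX coef_structure_poly //.
  case: ltnP => _ /=; first by rewrite mulr0 addr0 mulr0.
  rewrite -signr_odd; case: (odd j); rewrite ?expr1 ?expr0.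
    by rewrite mulN1r subrr mulr0.
  by rewrite mul1r -[RHS](mulKf two_neq0) mulr_natl mulr2n.
pose F j := defect_poly`_(q - j) * (2%:R^-1 *: (B + B^-))`_j.
have F0 j : (j < n)%N -> (j < 2)%N || odd j -> F j = 0.
  by move=> ltjn j0; rewrite /F coefE // j0 mulr0.
rewrite coefMr (@sum_by_parity _ F) ?F0 //; try lia.
rewrite [X in _ + X]big_nat_cond [X in _ + X]big1 ?addr0; last first.
  by move=> t /andP[/andP[t3 ltt] _]; apply: F0; lia.
apply: eq_big_nat => t /andP[t2 ltt]; rewrite /F coefE ?ifF; try lia.
by congr (_`_ _ * beta _); lia.
Qed.

Lemma coef_derivation_obstruction_sum q : (q.+1 < n)%N ->
  H`_q = (q%:R * a 1 - b2) * B`_q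
    + a 2 * \sum_(j < q.+2) j%:R * B`_(q.+1 - j) * B`_j.
Proof.
move=> ltqn.
have -> : H = 'X * B^`() * (a 1)%:P - b2 *: B + (a 2)%:P * (B * B^`()).
  by rewrite /H /shift_quot /structure_poly -!mul_polyC; ring.
have XB j : ('X * B^`())`_j = j%:R * B`_j.
  by rewrite coefXM; case: j => [|j]; rewrite ?mul0r //= coef_deriv mulr_natl.
rewrite coefD coefB coefMC coefZ XB coefCM.
rewrite (_ : (B * B^`())`_q = (B * ('X * B^`()))`_q.+1); last first.
  by rewrite mulrCA coefXM.
rewrite coefMr mulrBl mulrAC; congr (_ + _ * _); apply: eq_bigr => j _.
by rewrite XB mulrCA mulrA.
Qed.

(* The coefficient of B B' is read off from (B^2)' = 2 B B'. *)
Lemma coef_derivation_obstruction q : (q.+1 < n)%N ->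
  H`_q = (q%:R * a 1 - b2) * B`_q
    + (q + 1)%:R / 2%:R * a 2
      * \sum_(5 <= t < q + 3) beta (t - 1)%N * beta (q + 2 - t + 4)%N.
Proof.
move=> ltqn; rewrite coef_derivation_obstruction_sum //; congr (_ + _).
pose S := \sum_(j < q.+2) B`_(q.+1 - j) * B`_j.
have -> : \sum_(j < q.+2) j%:R * B`_(q.+1 - j) * B`_j = (q + 1)%:R / 2%:R * S.
  rewrite -[LHS](mulKf two_neq0) mulrC -mulrA mulrCA mulrC; congr (_ * _).
  (* Adding the sum to its reversal under j -> q + 1 - j replaces the weight j by the constant q +
     1. *)
  rewrite mulr_natl mulr2n {1}(reindex_inj rev_ord_inj) -big_split mulr_sumr /=.
  apply: eq_bigr => j _; rewrite subSS.
  have lejq : (j <= q.+1)%N by rewrite -ltnS.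
  by rewrite (natrB _ lejq) subKn // addn1; ring.
rewrite mulrCA mulrA; congr (_ * _).
(* With t = j + 3; the terms outside 2 <= j < q vanish because B starts in degree 2. *)
rewrite (_ : 5 = 2 + 3)%N // big_addn addnK.
rewrite (@big_nat_widen _ _ _ 2 q q.+2); last lia.
rewrite big_geq_mkord big_mkcond; apply: eq_bigr => j _ /=.
have ltjq := ltn_ord j; rewrite !coef_structure_poly; try lia.
have [lt_qj2|le2_qj] := ltnP (q.+1 - j) 2.
  by rewrite (_ : (j < q)%N = false) ?mul0r //; lia.
have [ltj2|le2j] := ltnP j 2; first by rewrite mulr0 andbF.
rewrite (_ : (j < q)%N = true) /= 1?mulrC; last lia.
by congr (beta _ * beta _); lia.
Qed.

Lemma dvd_obstructionsP :
  ('X^(n - 2) %| H + G /\ 'X^(n - 3) %| H - G) <->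
  (forall q, (q < n - 3)%N -> H`_q = 0) /\
  (forall q, (q < n - 3)%N -> G`_q = 0) /\
  H`_(n - 3) + G`_(n - 3) = 0.
Proof.
rewrite !dvdXnP; split=> [[HG HmG] | [H0 [G0 HG]]].
  have H0 q : (q < n - 3)%N -> H`_q = 0.
    move=> ltq; have := HmG _ ltq; have := HG q.
    rewrite (coefD H G) (coefB H G) => /(_ ltac:(lia)) /eqP.
    rewrite addr_eq0 => /eqP E.
    rewrite E -opprD => /eqP; rewrite oppr_eq0 -mulr2n -mulr_natl mulf_eq0.
    by rewrite (negPf two_neq0) /= => /eqP ->; rewrite oppr0.
  split=> //; split=> [q ltq|]; last by rewrite -(coefD H G) HG //; lia.
  by have := HG q; rewrite (coefD H G) H0 // add0r; apply; lia.
split=> q ltq; last by rewrite (coefB H G) H0 // G0 // subrr.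
rewrite (coefD H G); have [ltq'|leq'] := ltnP q (n - 3).
  by rewrite H0 // G0 // addr0.
by rewrite (_ : q = (n - 3)%N) //; lia.
Qed.

Lemma derivation_obstruction_eq0 k : (4 <= k < n)%N ->
  H`_(k - 2) = 0 <->
  (b2 - (k - 2)%:R * a 1%N) * beta k =
    (k - 1)%:R / 2%:R * a 2%N
      * \sum_(5 <= t < k.+1) beta (t - 1)%N * beta (k - t + 4)%N.
Proof.
move=> /andP[k4 ltkn]; rewrite coef_derivation_obstruction; last lia.
rewrite coef_structure_poly ?ifF; try lia.
rewrite (_ : (k - 2 + 1 = k - 1)%N); last lia.
rewrite (_ : (k - 2 + 3 = k.+1)%N) ?subnK; try lia.
set S := _ * \sum_(_ <= _ < _) _.
rewrite -opprB mulNr; split=> [/eqP|->]; last by rewrite addNr.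
by rewrite addrC subr_eq0 => /eqP.
Qed.

(** Degree k - 2 yields the equation for beta_k. Degree 2 lies below n - 3 only for n >= 6; for n =
    5 the equation for beta_4 comes from the hypothesis instead. *)
Lemma derivation_obstructionP : (n = 5%N -> beta 4 = 0) ->
  (forall q, (q < n - 3)%N -> H`_q = 0) <->
  (b2 - 2%:R * a 1%N) * beta 4%N = 0 /\
  (forall k : nat, (5 <= k <= n - 2)%N ->
     (b2 - (k - 2)%:R * a 1%N) * beta k =
     (k - 1)%:R / 2%:R * a 2%N
       * \sum_(5 <= t < k.+1) beta (t - 1)%N * beta (k - t + 4)%N).
Proof.
move=> beta4.
have main4 : H`_2 = 0 <-> (b2 - 2%:R * a 1%N) * beta 4%N = 0.
  by rewrite (@derivation_obstruction_eq0 4) ?big_geq ?mulr0 //; lia.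
split=> [H0 | [H4 Hk] q ltq].
  split=> [|k /andP[k5 lekn]]; last first.
    by apply/derivation_obstruction_eq0; [lia | apply: H0; lia].
  have [n_eq5|n_neq5] := eqVneq n 5%N; first by rewrite beta4 ?mulr0.
  by apply/main4/H0; lia.
case: q ltq => [|[|[|q]]] ltq; last first.
- have /derivation_obstruction_eq0 := Hk q.+3.+2 ltac:(lia).
  by rewrite subn2; apply; lia.
- exact/main4.
- rewrite coef_derivation_obstruction ?coef_structure_poly ?big_geq //; try lia.
  by rewrite !mulr0 addr0.
rewrite coef_derivation_obstruction ?coef_structure_poly ?big_geq //; try lia.
by rewrite !mulr0 addr0.
Qed.

(** The last term of the convolution pairs beta_(2k) with the constant term c_3 - 2 a_1 of delta;
    the others are shifted by t -> t + 1. In odd degrees this constant term is never met. *)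
Lemma coef_even_obstruction_even k : (2 <= k)%N -> (2 * k - 2 < n)%N ->
  G`_(2 * k - 2) = (c 3%N - 2%:R * a 1%N) * beta (2 * k)%N -
    \sum_(3 <= t < k.+1)
      (a (2 * k - 2 * t + 4)%N - c (2 * k - 2 * t + 5)%N
       + a 2%N * beta (2 * k - 2 * t + 5)%N) * beta (2 * t - 2)%N.
Proof.
move=> k2 ltkn; rewrite coef_even_obstruction //.
rewrite (_ : (2 * k - 2 + 4)./2 = k.+1); last lia.
rewrite big_nat_recr //= [LHS]addrC -sumrN [in RHS]big_add1 /=; congr (_ + _).
  by rewrite subnK ?subnn ?coef_defect0 //; lia.
apply: eq_big_nat => t /andP[t2 ltt].
rewrite (_ : 2 * k - 2 + 2 - 2 * t = (2 * k - 2 * t.+1 + 1).+1)%N; last lia.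
rewrite coef_defectS -?mulNr; last lia.
rewrite -!addnA (_ : (2 * t.+1 - 2 = 2 * t)%N); last lia.
by congr (_ * _); ring.
Qed.

Lemma coef_even_obstruction_odd k : (2 <= k)%N -> (2 * k - 3 < n)%N ->
  G`_(2 * k - 3) = -
    \sum_(3 <= t < k.+1)
      (a (2 * k - 2 * t + 3)%N - c (2 * k - 2 * t + 4)%N
       + a 2%N * beta (2 * k - 2 * t + 4)%N) * beta (2 * t - 2)%N.
Proof.
move=> k2 ltkn; rewrite coef_even_obstruction //.
rewrite (_ : (2 * k - 3 + 4)./2 = k); last lia.
rewrite -sumrN [in RHS]big_add1 /=.
apply: eq_big_nat => t /andP[t2 ltt].
rewrite (_ : 2 * k - 3 + 2 - 2 * t = (2 * k - 2 * t.+1).+1)%N; last lia.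
rewrite coef_defectS -?mulNr; last lia.
rewrite (_ : (2 * t.+1 - 2 = 2 * t)%N); last lia.
by congr (_ * _); ring.
Qed.

(** Degrees 2k - 3 give (2); degrees 2k - 2 give (3), and for k = 2 the first equation of (1), which
    for n = 5 again rests on the hypothesis. The ranges of k express q < n - 3. *)
Lemma even_obstructionP : (n = 5%N -> beta 4 = 0) ->
  (forall q, (q < n - 3)%N -> G`_q = 0) <->
  (c 3%N - 2%:R * a 1%N) * beta 4%N = 0 /\
  (forall k : nat, (3 <= k <= n.-1./2)%N ->
     \sum_(3 <= t < k.+1)
       (a (2 * k - 2 * t + 3)%N - c (2 * k - 2 * t + 4)%N
        + a 2%N * beta (2 * k - 2 * t + 4)%N) * beta (2 * t - 2)%N = 0) /\
  (forall k : nat, (3 <= k <= n./2 - 1)%N ->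
     (c 3%N - 2%:R * a 1%N) * beta (2 * k)%N =
     \sum_(3 <= t < k.+1)
       (a (2 * k - 2 * t + 4)%N - c (2 * k - 2 * t + 5)%N
        + a 2%N * beta (2 * k - 2 * t + 5)%N) * beta (2 * t - 2)%N).
Proof.
move=> beta4.
have even4 : G`_2 = (c 3%N - 2%:R * a 1%N) * beta 4%N.
  by rewrite (@coef_even_obstruction_even 2) ?big_geq ?subr0 //; lia.
split=> [G0 | [G2 [Godd Geven]] q ltq].
  split; last split.
  - have [n_eq5|n_neq5] := eqVneq n 5%N; first by rewrite beta4 ?mulr0.
    by rewrite -even4 G0 //; lia.
  - move=> k /andP[k3 lek]; apply/eqP; rewrite -oppr_eq0.
    by rewrite -coef_even_obstruction_odd ?G0 //; lia.
  move=> k /andP[k3 lek]; apply/eqP; rewrite -subr_eq0.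
  by rewrite -coef_even_obstruction_even ?G0 //; lia.
case: q ltq => [|[|[|q]]] ltq; last first.
- case: (boolP (odd q)) => odd_q.
    rewrite (_ : q.+3 = 2 * (q./2 + 3) - 2)%N; last lia.
    by rewrite coef_even_obstruction_even ?Geven ?subrr //; lia.
  rewrite (_ : q.+3 = 2 * (q./2 + 3) - 3)%N; last lia.
  by rewrite coef_even_obstruction_odd ?Godd ?oppr0 //; lia.
- by rewrite even4.
- by rewrite coef_even_obstruction ?big_geq //; lia.
by rewrite coef_even_obstruction ?big_geq //; lia.
Qed.

(** Here the weights j are not symmetrised: (5) and (6) keep the odd-index part separate and merge
    the even-index part with the coefficient of G. *)
Lemma coef_derivation_obstruction_top :
  H`_(n - 3) = ((n - 3)%:R * a 1 - b2) * beta (n - 1)%N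
    + a 2 * (\sum_(2 <= t < n./2)
               (2 * t - 2)%:R * beta (n - 2 * t + 2)%N * beta (2 * t)%N
             + \sum_(3 <= t < ((n - 1)./2).+1)
                 (2 * t - 3)%:R * beta (n - 2 * t + 3)%N * beta (2 * t - 1)%N).
Proof.
rewrite coef_derivation_obstruction_sum ?coef_structure_poly ?ifF; try lia.
rewrite (_ : (n - 3 + 2 = n - 1)%N); last lia.
congr (_ + _ * _); pose F j := j%:R * B`_((n - 3).+1 - j) * B`_j.
have B0 j : (j < 2)%N -> B`_j = 0.
  by move=> ltj; rewrite coef_structure_poly ?ltj //; lia.
rewrite (@sum_by_parity _ F) /F ?mul0r ?[B`_1]B0 ?mulr0 //.
rewrite (_ : ((n - 3).+1 + 4)./2 = n./2.+1); last lia.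
rewrite (_ : ((n - 3).+1 + 1)./2 + 2 = ((n - 1)./2).+2)%N; last lia.
congr (_ + _).
  rewrite big_nat_recr /=; last lia.
  rewrite (B0 ((n - 3).+1 - _)%N) ?mulr0 ?mul0r ?addr0; last lia.
  apply: eq_big_nat => t /andP[t2 ltt]; rewrite !coef_structure_poly; try lia.
  by rewrite !ifF; try lia; congr (_ * beta _ * beta _); lia.
rewrite big_nat_recr /=; last lia.
rewrite (B0 ((n - 3).+1 - _)%N) ?mulr0 ?mul0r ?addr0; last lia.
apply: eq_big_nat => t /andP[t2 ltt]; rewrite !coef_structure_poly; try lia.
by rewrite !ifF; try lia; congr (_ * beta _ * beta _); lia.
Qed.

(** The degree n - 3 is even exactly for odd n, and only then does the constant term of delta meet
    beta_(n-1). *)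
Lemma coef_even_obstruction_top :
  G`_(n - 3) = (if odd n then (c 3 - 2%:R * a 1) * beta (n - 1)%N else 0)
    + \sum_(2 <= t < n./2)
        (c (n - 2 * t + 2)%N - a (n - 2 * t + 1)%N
         - a 2%N * beta (n - 2 * t + 2)%N) * beta (2 * t)%N.
Proof.
rewrite coef_even_obstruction; last lia.
have defectE t : (t < n./2)%N -> defect_poly`_(n - 3 + 2 - 2 * t) =
    c (n - 2 * t + 2)%N - a (n - 2 * t + 1)%N - a 2%N * beta (n - 2 * t + 2)%N.
  move=> ltt; rewrite (_ : n - 3 + 2 - 2 * t = (n - 2 * t - 2).+1)%N; last lia.
  rewrite coef_defectS; last lia.
  by congr (c _ - a _ - _ * beta _); lia.
case: ifP => odd_n.
  rewrite (_ : (n - 3 + 4)./2 = n./2.+1); last lia.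
  rewrite big_nat_recr /= 1?addrC; last lia.
  rewrite (_ : n - 3 + 2 - 2 * n./2 = 0)%N ?coef_defect0; last lia.
  rewrite (_ : 2 * n./2 = n - 1)%N; last lia.
  by congr (_ + _); apply: eq_big_nat => t /andP[t2 ltt]; rewrite defectE.
rewrite (_ : (n - 3 + 4)./2 = n./2) ?add0r; last lia.
by apply: eq_big_nat => t /andP[t2 ltt]; rewrite defectE.
Qed.

Lemma top_obstructionP :
  H`_(n - 3) + G`_(n - 3) = 0 <->
  (odd n ->
     (b2 - c 3%N - (n - 5)%:R * a 1%N) * beta (n - 1)%N =
     a 2%N * (\sum_(3 <= t < ((n - 1)./2).+1)
                (2 * t - 3)%:R * beta (n - 2 * t + 3)%N * beta (2 * t - 1)%N)
     + \sum_(2 <= t < ((n - 3)./2).+1)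
         (c (n - 2 * t + 2)%N - a (n - 2 * t + 1)%N
          + (2 * t - 3)%:R * a 2%N * beta (n - 2 * t + 2)%N)
         * beta (2 * t)%N) /\
  (~~ odd n ->
     (b2 - (n - 3)%:R * a 1%N) * beta (n - 1)%N =
     a 2%N * (\sum_(3 <= t < ((n - 2)./2).+1)
                (2 * t - 3)%:R * beta (n - 2 * t + 3)%N * beta (2 * t - 1)%N)
     + \sum_(2 <= t < ((n - 2)./2).+1)
         (c (n - 2 * t + 2)%N - a (n - 2 * t + 1)%N
          + (2 * t - 3)%:R * a 2%N * beta (n - 2 * t + 2)%N)
         * beta (2 * t)%N).
Proof.
rewrite coef_derivation_obstruction_top coef_even_obstruction_top.
set S1 := \sum_(2 <= t < n./2) _; set S2 := \sum_(2 <= t < n./2) _.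
set T := \sum_(3 <= t < (n - 1)./2.+1) _.
have S12 : \sum_(2 <= t < n./2)
    (c (n - 2 * t + 2)%N - a (n - 2 * t + 1)%N
       + (2 * t - 3)%:R * a 2%N * beta (n - 2 * t + 2)%N) * beta (2 * t)%N
    = S2 + a 2 * S1.
  rewrite mulr_sumr -big_split; apply: eq_big_nat => t /andP[t2 _] /=.
  (* The weight 2t - 2 from B B' loses 1 to the term - a_2 beta of delta, whence 2t - 3. *)
  rewrite (_ : (2 * t - 2 = (2 * t - 3).+1)%N) -?[in RHS]natr1; last lia.
  by ring.
have zeroP (x y z : K) : z = y - x -> z = 0 <-> x = y.
  by move=> ->; split=> [/eqP|->]; rewrite ?subrr // subr_eq0 => /eqP ->.
have oddP (x y z : K) Q :
    z = y - x -> z = 0 <-> (true -> x = y) /\ (false -> Q).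
  by move=> E; have zP := zeroP _ _ _ E; split=> [/zP|[/(_ isT) /zP]].
have evenP (x y z : K) Q :
    z = y - x -> z = 0 <-> (false -> Q) /\ (true -> x = y).
  by move=> E; have zP := zeroP _ _ _ E; split=> [/zP|[_ /(_ isT) /zP]].
case: (boolP (odd n)) => odd_n /=.
  rewrite (_ : (n - 3)./2.+1 = n./2) ?S12; last lia.
  (* Joining (c_3 - 2 a_1) beta_(n-1) to the left side turns (n - 3) a_1 into (n - 5) a_1. *)
  by apply: oddP; rewrite (_ : (n - 3 = n - 5 + 2)%N) ?natrD; [ring | lia].
rewrite (_ : (n - 2)./2.+1 = n./2) ?S12; last lia.
rewrite -[in \sum_(3 <= t < n./2) _](_ : (n - 1)./2.+1 = n./2) -/T; last lia.
by apply: evenP; rewrite add0r; ring.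
Qed.

End Prederivation.
Lemma dvd_structure_polyP s : 'X^(n - 2) %| s *: B <->
  forall t : nat, (4 <= t <= n - 1)%N -> s * beta t = 0.
Proof.
rewrite dvdXnP; split=> [H t /andP[t4 letn] | H i lti].
  have := H (t - 2)%N; rewrite coefZ coef_structure_poly; last lia.
  by rewrite ifF ?subnK; [apply | | ]; lia.
rewrite coefZ coef_structure_poly; last lia.
by case: ltnP => [_|le2i]; rewrite ?mulr0 // H //; lia.
Qed.

(** * Reduction of an arbitrary pre-derivation to the polynomial form *)

Lemma of_poly_top b b' : b *: e n.-1 + b' *: e n =
  of_poly (b *: 'X^(n - 3) + b' *: 'X^(n - 2)).
Proof.
rewrite linearD !linearZ /= !of_poly_Xn !ifF; try lia.
by congr (_ *: e _ + _ *: e _); lia.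
Qed.

(** In the triple (e_2, e_1, e_1) every product starting with e_2 vanishes, so the polynomial part p
    of P(e_2) satisfies X^2 p = 0 modulo X^(n-1): only degrees n - 3 and n - 2 remain. *)
Lemma prederivation_e2 (P : {linear 'rV[K]_n -> 'rV[K]_n}) :
  is_prederivation br P ->
  exists b2 bn1 bn, P (e 2) = b2 *: e 2 + bn1 *: e n.-1 + bn *: e n.
Proof.
move=> derP; have [p [s Pe2]] := of_poly_decomp (P (e 2)).
have P2 : P (of_poly 0 + 1 *: e 2) = of_poly p + s *: e 2.
  by rewrite linear0 add0r scale1r.
have [q [t P1]] := of_poly_decomp (P (of_poly 1 + 0 *: e 2)).
have := derP (of_poly 0 + 1 *: e 2) (of_poly 1 + 0 *: e 2)
  (of_poly 1 + 0 *: e 2).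
rewrite P2 P1 !bracket3E !mul0r !linear0 !addr0 right_poly1.
move=> /esym /of_poly_eq0; rewrite -mulrA Xn_pred Xn_sub2 mulrA [_ * 'X^_]mulrC.
rewrite dvdp_mul2r ?mulf_neq0 ?polyX_eq0 // => /dvdpP[r pE].
exists s, (r`_0), (r`_1); rewrite Pe2 -addrA of_poly_top addrC; congr (_ + _).
apply/eqP; rewrite -subr_eq0 -linearB; apply/eqP/of_poly_eq0/dvdXnP => i lti.
rewrite pE !(coefB, coefD, coefZ, coefMXn, coefXn).
have [i3|i3] := eqVneq i (n - 3)%N.
  have -> : (i == n - 2)%N = false by lia.
  by rewrite i3 ltnn subnn mulr1 mulr0 addr0 subrr.
have [i2|i2] := eqVneq i (n - 2)%N.
  have -> : (i < n - 3)%N = false by lia.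
  have -> : (i - (n - 3) = 1)%N by lia.
  by rewrite mulr1 mulr0 add0r subrr.
have -> : (i < n - 3)%N by lia.
by rewrite !mulr0 addr0 subrr.
Qed.

(** In the triple (e_1, e_3, e_1) right multiplication by e_3 is zero, which leaves X (p_0 X + s B)
    = 0 modulo X^(n-1); as B starts in degree 2, p_0 = 0. *)
Lemma prederivation_e3 (P : {linear 'rV[K]_n -> 'rV[K]_n}) :
  is_prederivation br P -> coordinate (P (e 3)) 1 = 0.
Proof.
move=> derP; have [p [s Pe3]] := of_poly_decomp (P (e 3)).
have := derP (e 1) (e 3) (e 1); rewrite Pe3 ebase1E ebase3E.
have [q [t PE]] := of_poly_decomp (P (of_poly 1)).
rewrite PE (of_polyE 1) (of_polyE 'X) !bracket3E.
have -> : right_poly 'X 0 = 0 by rewrite /right_poly coefX !scale0r addr0.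
rewrite !(mulr0, mul0r) !linear0 add0r addr0 mul1r => /esym /of_poly_eq0.
rewrite right_poly1 right_polyE Xn_pred mulrAC -mulrA dvdp_mul2l ?polyX_eq0 //.
move=> /dvdXnP/(_ 1%N); rewrite coefXM /= /right_quot coefD coefC coefZ coefXM.
rewrite mulr0 addr0 => p0; have lt0n : (0 < n)%N by lia.
rewrite /coordinate (insubT (fun i => i < n)%N lt0n) /= !mxE /= mulr0 addr0.
by rewrite p0 //; lia.
Qed.

(** The classification in polynomial language, before images and divisibilities are read coefficient
    by coefficient. *)
Lemma prederivation_polyP (P : {linear 'rV[K]_n -> 'rV[K]_n}) :
  is_prederivation br P <->
  exists (a c : nat -> K) (b2 bn1 bn : K),
    (forall p, P (of_poly p) = of_poly (twisted_derivation a c p)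
       + (a 2 * p`_0 + c 2 * p`_1) *: e 2) /\
    P (e 2) = b2 *: e 2 + bn1 *: e n.-1 + bn *: e n /\
    [/\ 'X^(n - 2) %| c 2 *: B,
        'X^(n - 2) %| derivation_obstruction a b2 + even_obstruction a c &
        'X^(n - 3) %| derivation_obstruction a b2 - even_obstruction a c].
Proof.
have dvd_top (b b' : K) : 'X^(n - 3) %| b *: 'X^(n - 3) + b' *: 'X^(n - 2).
  by rewrite -!mul_polyC dvdp_add ?dvdp_mull // Xn_sub3.
have e2E b2 bn1 bn : b2 *: e 2 + bn1 *: e n.-1 + bn *: e n =
    of_poly (bn1 *: 'X^(n - 3) + bn *: 'X^(n - 2)) + b2 *: e 2.
  by rewrite -addrA of_poly_top addrC.
split=> [derP | [a [c [b2 [bn1 [bn [P_poly [P_e2 conds]]]]]]]]; last first.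
  move: P_e2; rewrite e2E => P_e2.
  by apply/(prederivationP _ _ _ _ _ P_poly P_e2 (dvd_top _ _)).
have [b2 [bn1 [bn P_e2]]] := prederivation_e2 _ derP.
pose a := coordinate (P (e 1)); pose c := coordinate (P (e 3)).
have P1 : P (of_poly 1) = of_poly (twisted_derivation a c 1) + a 2 *: e 2.
  by rewrite twisted_derivation1 -sum_ebase -coordinateE ebase1E.
have P3 : P (of_poly 'X) = of_poly (twisted_derivation a c 'X) + c 2 *: e 2.
  rewrite -form_e3 -ebase3E [LHS]coordinateE big_ltn; last lia.
  by rewrite prederivation_e3 // scale0r add0r.
have P_poly := prederivation_poly_image _ _ _ derP P1 P3.
exists a, c, b2, bn1, bn; do 2!split=> //.
move: P_e2; rewrite e2E => P_e2.
by apply/(prederivationP _ _ _ _ _ P_poly P_e2 (dvd_top _ _)).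
Qed.

End Bracket.
End Model.
Theorem proposition3p2 (R : realType) (n : nat) (hn : (5 <= n)%N)
    (beta : nat -> R[i]) (gamma : R[i])
    (hbeta : n = 5%N -> beta 4%N = 0)
    (P : {linear 'rV[R[i]]_n -> 'rV[R[i]]_n}) :
  let e := ebase R[i] n in
  is_prederivation (F2_bracket (n := n) beta gamma) P <->
  exists (a c : nat -> R[i]) (b2 bn1 bn : R[i]),
    (P (e 1%N) = \sum_(1 <= t < n.+1) a t *: e t /\
     P (e 2%N) = b2 *: e 2%N + bn1 *: e n.-1 + bn *: e n /\
     P (e 3%N) = \sum_(2 <= t < n.+1) c t *: e t /\
     (forall i : nat, (2 <= i <= n./2)%N ->
        P (e (2 * i)%N) =
          ((2 * i - 1)%:R * a 1%N) *: e (2 * i)%N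
          + \sum_(2 * i + 1 <= t < n.+1)
              (a (t - 2 * i + 2)%N
               + (2 * i - 2)%:R * a 2%N * beta (t - 2 * i + 3)%N) *: e t) /\
     (forall i : nat, (2 <= i <= n.-1./2)%N ->
        P (e (2 * i + 1)%N) =
          ((2 * i - 2)%:R * a 1%N + c 3%N) *: e (2 * i + 1)%N
          + \sum_(2 * i + 2 <= t < n.+1)
              (c (t - 2 * i + 2)%N
               + (2 * i - 2)%:R * a 2%N * beta (t - 2 * i + 2)%N) *: e t)) /\
    (* (1) *)
    ((c 3%N - 2%:R * a 1%N) * beta 4%N = 0 /\
     (b2 - 2%:R * a 1%N) * beta 4%N = 0 /\
     (forall t : nat, (4 <= t <= n - 1)%N -> c 2%N * beta t = 0)) /\
    (* (2) *)
    (forall k : nat, (3 <= k <= n.-1./2)%N ->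
       \sum_(3 <= t < k.+1)
         (a (2 * k - 2 * t + 3)%N - c (2 * k - 2 * t + 4)%N
          + a 2%N * beta (2 * k - 2 * t + 4)%N) * beta (2 * t - 2)%N = 0) /\
    (* (3) *)
    (forall k : nat, (3 <= k <= n./2 - 1)%N ->
       (c 3%N - 2%:R * a 1%N) * beta (2 * k)%N =
       \sum_(3 <= t < k.+1)
         (a (2 * k - 2 * t + 4)%N - c (2 * k - 2 * t + 5)%N
          + a 2%N * beta (2 * k - 2 * t + 5)%N) * beta (2 * t - 2)%N) /\
    (* (4) *)
    (forall k : nat, (5 <= k <= n - 2)%N ->
       (b2 - (k - 2)%:R * a 1%N) * beta k =
       (k - 1)%:R / 2%:R * a 2%N
         * \sum_(5 <= t < k.+1) beta (t - 1)%N * beta (k - t + 4)%N) /\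
    (* (5) *)
    (odd n ->
       (b2 - c 3%N - (n - 5)%:R * a 1%N) * beta (n - 1)%N =
       a 2%N * (\sum_(3 <= t < ((n - 1)./2).+1)
                  (2 * t - 3)%:R * beta (n - 2 * t + 3)%N * beta (2 * t - 1)%N)
       + \sum_(2 <= t < ((n - 3)./2).+1)
           (c (n - 2 * t + 2)%N - a (n - 2 * t + 1)%N
            + (2 * t - 3)%:R * a 2%N * beta (n - 2 * t + 2)%N)
           * beta (2 * t)%N) /\
    (* (6) *)
    (~~ odd n ->
       (b2 - (n - 3)%:R * a 1%N) * beta (n - 1)%N =
       a 2%N * (\sum_(3 <= t < ((n - 2)./2).+1)
                  (2 * t - 3)%:R * beta (n - 2 * t + 3)%N * beta (2 * t - 1)%N)
       + \sum_(2 <= t < ((n - 2)./2).+1)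
           (c (n - 2 * t + 2)%N - a (n - 2 * t + 1)%N
            + (2 * t - 3)%:R * a 2%N * beta (n - 2 * t + 2)%N)
           * beta (2 * t)%N).

Proof.
move=> e; have two_neq0 : 2%:R != 0 :> R[i] by rewrite Num.Theory.pnatr_eq0.
rewrite (prederivation_polyP _ _ hn two_neq0).
split=> [[a [c [b2 [bn1 [bn [P_poly [P_e2 [c2B HG HmG]]]]]]]] |].
  exists a, c, b2, bn1, bn.
  have [P_e1 [P_e3 [P_even P_odd]]] :=
    (formsP _ _ hn two_neq0 _ _ _ _).1 P_poly.
  have [/(derivation_obstructionP _ _ hn two_neq0 _ _ _ hbeta)[b4 H4]
    [/(even_obstructionP _ _ hn two_neq0 _ _ _ hbeta)[c4 [G2 G3]]
     /(top_obstructionP _ _ hn two_neq0)[H5 H6]]] :=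
    (dvd_obstructionsP _ _ hn two_neq0 _ _ _ _).1 (conj HG HmG).
  by move/(dvd_structure_polyP _ _ hn two_neq0): c2B => c2B; do !split.
move=> [a [c [b2 [bn1 [bn [[P_e1 [P_e2 [P_e3 [P_even P_odd]]]]
  [[c4 [b4 c2B]] [G2 [G3 [H4 [H5 H6]]]]]]]]]]].
exists a, c, b2, bn1, bn; split; first exact/(formsP _ _ hn two_neq0).
split=> //.
have [HG HmG] :
    'X^(n - 2) %| derivation_obstruction _ n beta a b2
                  + even_obstruction _ n beta a c /\
    'X^(n - 3) %| derivation_obstruction _ n beta a b2
                  - even_obstruction _ n beta a c.
  apply/(dvd_obstructionsP _ _ hn two_neq0); split.
    exact/(derivation_obstructionP _ _ hn two_neq0).
  split; first exact/(even_obstructionP _ _ hn two_neq0).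
  exact/(top_obstructionP _ _ hn two_neq0).
by split=> //; apply/(dvd_structure_polyP _ _ hn two_neq0).
Qed.
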